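(* Let $a<b$ be real numbers and let $f\in C^4([a,b])$ be real-valued. Define $E^S(f)$ by $$\int_a^b f(x)\,dx=\frac{b-a}{6}\left[f(a)+4f\!\left(\frac{a+b}{2}\right)+f(b)\right]+E^S(f).$$ Then $$|E^S(f)|\leq \frac{(b-a)^5\|f^{(4)}\|_\infty}{2880}.$$ Moreover (composite Simpson's rule), for every even natural number $n\geq 2$, setting $x_i=a+(b-a)i/n$ for $0\leq i\leq n$ and defining $E^S_n(f)$ by $$\int_a^b f(x)\,dx=\frac{b-a}{3n}\left[f(a)+2\sum_{i=1}^{n/2-1}f(x_{2i})+4\sum_{i=1}^{n/2}f(x_{2i-1})+f(b)\right]+E^S_n(f),$$ one has $$|E^S_n(f)|\leq\frac{(b-a)^5\|f^{(4)}\|_\infty}{180n^4}.$$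
   Context: $C^4([a,b])$ denotes the functions on $[a,b]$ that are continuous together with their derivatives up to order $4$ on $[a,b]$ (one-sided derivatives at the endpoints). $\|g\|_\infty=\sup_{x\in[a,b]}|g(x)|$ is the uniform norm on $[a,b]$. An empty sum is $0$. *)

(* Defs.v *)
From Stdlib Require Import Reals.
From Coquelicot Require Import Coquelicot.
Open Scope R_scope.

Definition Icc (a b x : R) : Prop := a <= x <= b.

(* A function on [a,b] is a total function R -> R whose values outside [a,b]
   are irrelevant: the difference quotient in Stdlib's [D_in] only ranges over
   points of the given domain, hence is one-sided at the endpoints. *)
Definition ex_derive_on (a b : R) (f : R -> R) (x : R) : Prop :=
  exists l : R, D_in f (fun _ => l) (Icc a b) x.

(* Meaningful for a < b and x in [a,b], where the derivative is unique when it
   exists. *)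
Definition Derive_on (a b : R) (f : R -> R) (x : R) : R :=
  iota (fun l : R => D_in f (fun _ => l) (Icc a b) x).

Fixpoint Derive_n_on (a b : R) (f : R -> R) (n : nat) : R -> R :=
  match n with
  | O => f
  | S m => Derive_on a b (Derive_n_on a b f m)
  end.

Definition C_on (n : nat) (a b : R) (f : R -> R) : Prop :=
  (forall (k : nat) (x : R), (k < n)%nat -> Icc a b x ->
     ex_derive_on a b (Derive_n_on a b f k) x) /\
  (forall (k : nat) (x : R), (k <= n)%nat -> Icc a b x ->
     continue_in (Derive_n_on a b f k) (Icc a b) x).

(* [real] sends an infinite supremum to 0; the supremum is finite when g is
   continuous on [a,b] and a <= b. *)
Definition sup_norm (a b : R) (g : R -> R) : R :=
  real (Lub_Rbar (fun y => exists x, Icc a b x /\ y = Rabs (g x))).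

Definition simpson (a b : R) (f : R -> R) : R :=
  (b - a) / 6 * (f a + 4 * f ((a + b) / 2) + f b).

Definition simpson_error (a b : R) (f : R -> R) : R :=
  RInt f a b - simpson a b f.

Definition node (a b : R) (n i : nat) : R := a + (b - a) * INR i / INR n.

(* [sum_n_m u p q] is 0 when q < p, which covers n = 2 in the first sum. *)
Definition composite_simpson (a b : R) (n : nat) (f : R -> R) : R :=
  (b - a) / (3 * INR n) *
  (f a
   + 2 * sum_n_m (fun i => f (node a b n (2 * i))) 1 (n / 2 - 1)
   + 4 * sum_n_m (fun i => f (node a b n (2 * i - 1))) 1 (n / 2)
   + f b).

Definition composite_simpson_error (a b : R) (n : nat) (f : R -> R) : R :=
  RInt f a b - composite_simpson a b n f.

(* Main.v *)
Require Import Defs.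
From Stdlib Require Import Reals.
From Coquelicot Require Import Coquelicot.
From Stdlib Require Import Lra Lia.
Open Scope R_scope.

(** For a panel with midpoint [m] and half-width [t], put
      E(t) = int_{m-t}^{m+t} f - (t/3) (f(m-t) + 4 f(m) + f(m+t)).
    The weights of Simpson's rule are exactly those for which E, E' and E''
    vanish at 0 while all derivatives of order at most 2 cancel from E''':
      E'''(t) = - (t/3) (f'''(m+t) - f'''(m-t)).
    If |f''''| <= M, the bracket is at most 2Mt, so |E'''(t)| <= (2/3) M t^2,
    and three integrations from 0 give |E(t)| <= M t^5 / 90.  With t = (d-c)/2
    this is M (d-c)^5 / 2880 ([simpson_panel]).  Every integration step is the
    comparison principle [abs_le_of_derive_le], a consequence of the mean value
    theorem.  The composite rule is the sum of n/2 panels of width 2(b-a)/n, and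
    the n/2 panel errors add up to M (b-a)^5 / (180 n^4) ([composite_panels]).

    The hypotheses give only one-sided information at [a] and [b].  Composing
    each derivative of f with the projection of the line onto [a,b] makes it
    continuous everywhere without changing it on [a,b], and the mean value
    theorem needs derivatives only at interior points. *)

(** * Comparison of functions through their derivatives *)

Lemma nonneg_of_derive_nonneg (T : R) (w dw : R -> R) :
  (forall t, continuous w t) ->
  (forall t, 0 < t < T -> is_derive w t (dw t)) ->
  (forall t, 0 <= t <= T -> 0 <= dw t) ->
  w 0 = 0 ->
  forall t, 0 <= t <= T -> 0 <= w t.
Proof.
  intros Hc Hd Hp H0 t Ht.
  destruct (MVT_gen w 0 t dw) as [c [Hct Hw]].
  - rewrite Rmin_left, Rmax_right by lra. intros x Hx. apply Hd. lra.
  - intros x _. apply continuity_pt_filterlim. apply Hc.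
  - rewrite Rmin_left, Rmax_right in Hct by lra.
    assert (0 <= dw c) by (apply Hp; lra). nra.
Qed.

(** The mean value form of integrating [Rabs (du t) <= dv t] from 0. *)
Lemma abs_le_of_derive_le (T : R) (u du v dv : R -> R) :
  (forall t, continuous u t) -> (forall t, continuous v t) ->
  (forall t, 0 < t < T -> is_derive u t (du t)) ->
  (forall t, 0 < t < T -> is_derive v t (dv t)) ->
  (forall t, 0 <= t <= T -> Rabs (du t) <= dv t) ->
  u 0 = 0 -> v 0 = 0 ->
  forall t, 0 <= t <= T -> Rabs (u t) <= v t.
Proof.
  intros Hu Hv Hdu Hdv Hle Hu0 Hv0 t Ht.
  assert (0 <= v t - u t).
  { apply (nonneg_of_derive_nonneg T (fun s => v s - u s)
             (fun s => dv s - du s)); try easy.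
    - intros s. apply (continuous_minus (V := R_NormedModule) v u); auto.
    - intros s Hs. apply (is_derive_minus (V := R_NormedModule) v u); auto.
    - intros s Hs. specialize (Hle s Hs). apply Rabs_le_between in Hle. lra.
    - lra. }
  assert (0 <= v t + u t).
  { apply (nonneg_of_derive_nonneg T (fun s => v s + u s)
             (fun s => dv s + du s)); try easy.
    - intros s. apply (continuous_plus (V := R_NormedModule) v u); auto.
    - intros s Hs. apply (is_derive_plus (V := R_NormedModule) v u); auto.
    - intros s Hs. specialize (Hle s Hs). apply Rabs_le_between in Hle. lra.
    - lra. }
  apply Rabs_le_between. lra.
Qed.

(** * Simpson's rule on one panel *)

Ltac prove_continuous :=
  intros ?;
  repeat first
    [ assumption
    | match goal with H : forall x, continuous ?F x |- continuous ?F _ =>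
        apply H end
    | apply continuous_const | apply continuous_id
    | match goal with
      | |- continuous (fun x => @?f x + @?g x) _ =>
          apply (continuous_plus (V := R_NormedModule) f g)
      | |- continuous (fun x => @?f x - @?g x) _ =>
          apply (continuous_minus (V := R_NormedModule) f g)
      | |- continuous (fun x => @?f x * @?g x) _ =>
          apply (continuous_mult (K := R_AbsRing) f g)
      | |- continuous (fun x => @?f x ^ S ?n) _ =>
          apply (continuous_mult (K := R_AbsRing) f (fun x => f x ^ n))
      | |- continuous (fun x => _ ^ 0) _ => apply continuous_const
      | |- continuous (fun x => ?F (@?f x)) _ =>
          apply (continuous_comp f F)
      end ].

(* Differentiates an expression in [F (m + t)] and [F (m - t)], given in the
   context the derivatives of the functions F on the panel. *)
Ltac derive_symmetric m t :=
  repeat match goal with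
  | H : forall x, _ < x < _ -> is_derive _ x _ |- _ =>
      let Hp := fresh "Dp" in let Hm := fresh "Dm" in
      assert (Hp := H (m + t) ltac:(lra));
      assert (Hm := H (m - t) ltac:(lra)); clear H
  end;
  auto_derive;
  [ repeat split; eexists; eassumption
  | change (m + - t) with (m - t);
    repeat match goal with
    | H : is_derive ?F ?x ?l |- context [Derive ?g ?x] =>
        replace (Derive g x) with l
          by (symmetry; exact (is_derive_unique F x l H))
    end; field ].

(** [G] is an antiderivative of [F0], so the left-hand side is |E(t)|, and each
    [F_(k+1)] is the derivative of [F_k].  The functions bounded by [B1] and [B2]
    are E' and E''; [B3] controls the bracket in E'''. *)
Lemma symmetric_simpson_bound (m T M : R) (G F0 F1 F2 F3 F4 : R -> R) :
  (forall x, continuous G x) -> (forall x, continuous F0 x) ->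
  (forall x, continuous F1 x) -> (forall x, continuous F2 x) ->
  (forall x, continuous F3 x) ->
  (forall x, m - T < x < m + T -> is_derive G x (F0 x)) ->
  (forall x, m - T < x < m + T -> is_derive F0 x (F1 x)) ->
  (forall x, m - T < x < m + T -> is_derive F1 x (F2 x)) ->
  (forall x, m - T < x < m + T -> is_derive F2 x (F3 x)) ->
  (forall x, m - T < x < m + T -> is_derive F3 x (F4 x)) ->
  (forall x, m - T <= x <= m + T -> Rabs (F4 x) <= M) ->
  forall t, 0 <= t <= T ->
  Rabs (G (m + t) - G (m - t) - t / 3 * (F0 (m - t) + 4 * F0 m + F0 (m + t)))
    <= M * t ^ 5 / 90.
Proof.
  intros CG C0 C1 C2 C3 DG D0 D1 D2 D3 HM.
  assert (B3 : forall t, 0 <= t <= T ->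
            Rabs (F3 (m + t) - F3 (m - t)) <= 2 * M * t).
  { apply (abs_le_of_derive_le T _ (fun t => F4 (m + t) + F4 (m - t))
             (fun t => 2 * M * t) (fun _ => 2 * M)); try solve [prove_continuous].
    - intros t Ht. derive_symmetric m t.
    - intros t Ht. derive_symmetric m t.
    - intros t Ht.
      assert (Hp := HM (m + t) ltac:(lra)).
      assert (Hm := HM (m - t) ltac:(lra)).
      apply Rabs_le_between in Hp. apply Rabs_le_between in Hm.
      apply Rabs_le_between. lra.
    - rewrite Rplus_0_r, Rminus_0_r. ring.
    - ring. }
  assert (B2 : forall t, 0 <= t <= T ->
            Rabs (1 / 3 * (F1 (m + t) - F1 (m - t))
                  - t / 3 * (F2 (m + t) + F2 (m - t)))
              <= 2 / 9 * M * t ^ 3).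
  (* The derivative of E'' is E''': the terms in F2 cancel. *)
  { apply (abs_le_of_derive_le T _
             (fun t => - (t / 3) * (F3 (m + t) - F3 (m - t)))
             (fun t => 2 / 9 * M * t ^ 3) (fun t => 2 / 3 * M * t ^ 2));
      try solve [unfold Rdiv; prove_continuous].
    - intros t Ht. derive_symmetric m t.
    - intros t Ht. derive_symmetric m t.
    - intros t Ht. specialize (B3 t Ht).
      rewrite Rabs_mult, Rabs_Ropp, (Rabs_pos_eq (t / 3)) by lra.
      apply Rmult_le_compat_l with (r := t / 3) in B3; [|lra].
      apply Rle_trans with (1 := B3). right. field.
    - rewrite Rplus_0_r, Rminus_0_r. field.
    - ring. }
  assert (B1 : forall t, 0 <= t <= T ->
            Rabs (2 / 3 * (F0 (m + t) + F0 (m - t)) - 4 / 3 * F0 m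
                  - t / 3 * (F1 (m + t) - F1 (m - t)))
              <= M * t ^ 4 / 18).
  { apply (abs_le_of_derive_le T _
           (fun t => 1 / 3 * (F1 (m + t) - F1 (m - t))
                     - t / 3 * (F2 (m + t) + F2 (m - t)))
           (fun t => M * t ^ 4 / 18) (fun t => 2 / 9 * M * t ^ 3));
      [ | | | | exact B2 | | ];
      try solve [unfold Rdiv; prove_continuous].
    - intros t Ht. derive_symmetric m t.
    - intros t Ht. derive_symmetric m t.
    - rewrite Rplus_0_r, Rminus_0_r. field.
    - field. }
  apply (abs_le_of_derive_le T _
         (fun t => 2 / 3 * (F0 (m + t) + F0 (m - t)) - 4 / 3 * F0 m
                   - t / 3 * (F1 (m + t) - F1 (m - t)))
         (fun t => M * t ^ 5 / 90) (fun t => M * t ^ 4 / 18));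
    [ | | | | exact B1 | | ];
    try solve [unfold Rdiv; prove_continuous].
  - intros t Ht. derive_symmetric m t.
  - intros t Ht. derive_symmetric m t.
  - rewrite Rplus_0_r, Rminus_0_r. field.
  - field.
Qed.

(** Continuity is asked on the whole line so that the antiderivative of [F0]
    is differentiable at [c] and [d] too; derivatives are asked only inside the
    panel. *)
Lemma simpson_panel (c d M : R) (F0 F1 F2 F3 F4 : R -> R) :
  c <= d ->
  (forall x, continuous F0 x) -> (forall x, continuous F1 x) ->
  (forall x, continuous F2 x) -> (forall x, continuous F3 x) ->
  (forall x, c < x < d -> is_derive F0 x (F1 x)) ->
  (forall x, c < x < d -> is_derive F1 x (F2 x)) ->
  (forall x, c < x < d -> is_derive F2 x (F3 x)) ->
  (forall x, c < x < d -> is_derive F3 x (F4 x)) ->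
  (forall x, c <= x <= d -> Rabs (F4 x) <= M) ->
  Rabs (simpson_error c d F0) <= (d - c) ^ 5 * M / 2880.
Proof.
  intros Hcd C0 C1 C2 C3 D0 D1 D2 D3 HM.
  assert (DG : forall x, is_derive (RInt F0 c) x (F0 x)).
  { intros x. apply (is_derive_RInt (V := R_NormedModule) F0 _ c x); [|apply C0].
    apply filter_forall. intros y.
    apply (RInt_correct (V := R_CompleteNormedModule)).
    apply (ex_RInt_continuous (V := R_CompleteNormedModule)). auto. }
  assert (CG : forall x, continuous (RInt F0 c) x).
  { intros x. apply (ex_derive_continuous (V := R_NormedModule)).
    exists (F0 x). apply DG. }
  set (m := (c + d) / 2). set (T := (d - c) / 2).
  assert (HmT : m - T = c /\ m + T = d) by (unfold m, T; lra).
  destruct HmT as [Em Ep].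
  assert (B := symmetric_simpson_bound m T M (RInt F0 c) F0 F1 F2 F3 F4).
  rewrite Em, Ep in B.
  specialize (B CG C0 C1 C2 C3 (fun x _ => DG x) D0 D1 D2 D3 HM T).
  specialize (B ltac:(unfold T; lra)).
  rewrite Em, Ep, (RInt_point c F0) in B.
  change (@zero R_CompleteNormedModule) with 0 in B.
  unfold simpson_error, simpson. fold m.
  replace (RInt F0 c d - (d - c) / 6 * (F0 c + 4 * F0 m + F0 d))
    with (RInt F0 c d - 0 - T / 3 * (F0 c + 4 * F0 m + F0 d))
    by (unfold T; field).
  apply Rle_trans with (1 := B). right. unfold T. field.
Qed.

(** * One-sided derivatives and projection onto the interval *)

Definition proj_Icc (a b x : R) : R := Rmax a (Rmin b x).

Lemma proj_Icc_in (a b x : R) : a <= b -> Icc a b (proj_Icc a b x).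
Proof.
  intros Hab. unfold Icc, proj_Icc. split; [apply Rmax_l|].
  apply Rmax_lub; [easy|apply Rmin_l].
Qed.

Lemma proj_Icc_id (a b x : R) : Icc a b x -> proj_Icc a b x = x.
Proof.
  intros [H1 H2]. unfold proj_Icc. now rewrite Rmin_right, Rmax_right.
Qed.

Lemma proj_Icc_lipschitz (a b x y : R) :
  a <= b -> Rabs (proj_Icc a b x - proj_Icc a b y) <= Rabs (x - y).
Proof.
  intros Hab. unfold proj_Icc, Rmax, Rmin.
  repeat destruct Rle_dec; unfold Rabs; repeat destruct Rcase_abs; lra.
Qed.

Lemma continuous_comp_proj_Icc (a b : R) (g : R -> R) :
  a <= b -> (forall x, Icc a b x -> continue_in g (Icc a b) x) ->
  forall x, continuous (fun y => g (proj_Icc a b y)) x.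
Proof.
  intros Hab Hg x. apply continuity_pt_filterlim.
  intros eps Heps.
  destruct (Hg _ (proj_Icc_in a b x Hab) eps Heps) as [d [Hd H]].
  exists d. split; [easy|]. intros y [_ Hy].
  simpl in H, Hy |- *. unfold Rdist in *.
  destruct (Req_dec (proj_Icc a b x) (proj_Icc a b y)) as [E|E].
  - rewrite E, Rminus_diag, Rabs_R0. exact Heps.
  - apply H. split; [split; [now apply proj_Icc_in|easy]|].
    apply Rle_lt_trans with (2 := Hy). now apply proj_Icc_lipschitz.
Qed.

Lemma is_derive_of_D_in (a b x l : R) (g : R -> R) :
  a < x < b -> D_in g (fun _ => l) (Icc a b) x -> is_derive g x l.
Proof.
  intros Hx Hg. apply is_derive_Reals. intros eps Heps.
  destruct (Hg eps Heps) as [d [Hd H]].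
  assert (Hpos : 0 < Rmin d (Rmin (x - a) (b - x))).
  { repeat apply Rmin_pos; lra. }
  exists (mkposreal _ Hpos). intros h Hh Hlt. simpl in Hlt.
  assert (H1 := Rlt_le_trans _ _ _ Hlt (Rmin_l _ _)).
  assert (H2 := Rlt_le_trans _ _ _ Hlt (Rmin_r _ _)).
  assert (H3 := Rlt_le_trans _ _ _ H2 (Rmin_l _ _)).
  assert (H4 := Rlt_le_trans _ _ _ H2 (Rmin_r _ _)).
  apply Rabs_lt_between in H3. apply Rabs_lt_between in H4.
  specialize (H (x + h)). simpl in H. unfold Rdist in H.
  replace (x + h - x) with h in H by ring.
  apply H. repeat split; unfold Icc; lra.
Qed.

(** A relative derivative at an interior point is an ordinary one, hence unique,
    which is what the description operator in [Derive_on] needs. *)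
Lemma is_derive_Derive_on (a b x : R) (g : R -> R) :
  a < x < b -> ex_derive_on a b g x -> is_derive g x (Derive_on a b g x).
Proof.
  intros Hx [l Hl]. apply (is_derive_of_D_in a b); [easy|].
  apply (iota_correct (V := R_CompleteNormedModule)
           (fun l => D_in g (fun _ => l) (Icc a b) x)).
  exists l. split; [easy|]. intros l' Hl'.
  apply (is_derive_of_D_in a b) in Hl; [|easy].
  apply (is_derive_of_D_in a b) in Hl'; [|easy].
  rewrite <- (is_derive_unique g x l Hl). exact (is_derive_unique g x l' Hl').
Qed.

(** The projection is the identity near an interior point, so it does not affect
    the derivative there; the derivative is again written with the projection so
    that the statement can be iterated. *)
Lemma is_derive_comp_proj_Icc (a b x : R) (g : R -> R) :
  a < x < b -> ex_derive_on a b g x ->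
  is_derive (fun y => g (proj_Icc a b y)) x
    (Derive_on a b g (proj_Icc a b x)).
Proof.
  intros Hx Hg. rewrite proj_Icc_id by (unfold Icc; lra).
  apply is_derive_ext_loc with g; [|now apply is_derive_Derive_on].
  apply (locally_interval _ x a b); simpl; try lra.
  intros y Ha Hb. simpl in Ha, Hb. rewrite proj_Icc_id; [easy|unfold Icc; lra].
Qed.

(** Continuity on the compact interval makes the least upper bound finite, so
    that its real part is a genuine upper bound. *)
Lemma Rabs_le_sup_norm (a b : R) (g : R -> R) :
  a <= b -> (forall x, Icc a b x -> continue_in g (Icc a b) x) ->
  forall x, Icc a b x -> Rabs (g x) <= sup_norm a b g.
Proof.
  intros Hab Hg x Hx.
  assert (Hc := continuous_comp_proj_Icc a b g Hab Hg).
  destruct (continuity_ab_maj (fun y => Rabs (g (proj_Icc a b y))) a b Hab)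
    as [y0 [Hy0 _]].
  { intros c _. apply continuity_pt_filterlim.
    apply (continuous_comp (fun y => g (proj_Icc a b y)) Rabs); [apply Hc|].
    apply continuous_Rabs. }
  set (B := Rabs (g (proj_Icc a b y0))) in Hy0.
  unfold sup_norm.
  set (E := fun y => exists z, Icc a b z /\ y = Rabs (g z)).
  destruct (Lub_Rbar_correct E) as [Hub Hleast].
  assert (HB : Rbar_le (Lub_Rbar E) B).
  { apply Hleast. intros y [z [Hz ->]]. simpl. specialize (Hy0 z Hz).
    simpl in Hy0. now rewrite (proj_Icc_id a b z Hz) in Hy0. }
  assert (Hle : Rbar_le (Rabs (g x)) (Lub_Rbar E)).
  { apply Hub. now exists x. }
  destruct (Lub_Rbar E); simpl in *; easy.
Qed.

(** * The panel bound on subintervals *)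

Lemma ex_RInt_of_continue_in (a b c d : R) (f : R -> R) :
  (forall x, Icc a b x -> continue_in f (Icc a b) x) ->
  a <= c -> c <= d -> d <= b -> ex_RInt f c d.
Proof.
  intros Hf Hac Hcd Hdb.
  apply ex_RInt_ext with (fun x => f (proj_Icc a b x)).
  - rewrite Rmin_left, Rmax_right by easy. intros x Hx.
    rewrite proj_Icc_id; [easy|unfold Icc; lra].
  - apply (ex_RInt_continuous (V := R_CompleteNormedModule)). intros x _.
    apply continuous_comp_proj_Icc; [lra|easy].
Qed.

Lemma simpson_error_ext (c d : R) (f g : R -> R) :
  c <= d -> (forall x, c <= x <= d -> f x = g x) ->
  simpson_error c d f = simpson_error c d g.
Proof.
  intros Hcd H. unfold simpson_error, simpson.
  rewrite !(H c), !(H d), !(H ((c + d) / 2)) by lra.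
  f_equal. apply RInt_ext. rewrite Rmin_left, Rmax_right by easy.
  intros x Hx. apply H. lra.
Qed.

Lemma simpson_error_le (a b c d : R) (f : R -> R) :
  C_on 4 a b f -> a <= c -> c <= d -> d <= b ->
  Rabs (simpson_error c d f)
    <= (d - c) ^ 5 * sup_norm a b (Derive_n_on a b f 4) / 2880.
Proof.
  intros [Hd Hc] Hac Hcd Hdb.
  assert (Hab : a <= b) by lra.
  set (F := fun k y => Derive_n_on a b f k (proj_Icc a b y)).
  assert (CF : forall k, (k <= 4)%nat -> forall x, continuous (F k) x).
  { intros k Hk. apply continuous_comp_proj_Icc; [easy|]. intros x.
    now apply Hc. }
  assert (DF : forall k, (k < 4)%nat -> forall x, c < x < d ->
            is_derive (F k) x (F (S k) x)).
  { intros k Hk x Hx. apply is_derive_comp_proj_Icc; [lra|].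
    apply Hd; [easy|unfold Icc; lra]. }
  rewrite (simpson_error_ext c d f (F 0%nat) Hcd).
  - apply (simpson_panel c d _ (F 0%nat) (F 1%nat) (F 2%nat) (F 3%nat) (F 4%nat));
      try (apply CF; lia); try (apply DF; lia); [easy|].
    intros x _.
    apply (Rabs_le_sup_norm a b (Derive_n_on a b f 4) Hab
             (fun y => Hc 4%nat y (le_n 4))).
    now apply proj_Icc_in.
  - intros x Hx. unfold F. simpl. rewrite proj_Icc_id; [easy|unfold Icc; lra].
Qed.

(** * The composite rule *)

Lemma node_add_2 (a b : R) (n i : nat) :
  (0 < n)%nat -> node a b n (i + 2) = node a b n i + 2 * ((b - a) / INR n).
Proof.
  intros Hn. apply lt_0_INR in Hn. unfold node.
  rewrite plus_INR. simpl (INR 2). field. lra.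
Qed.

Lemma node_add_1 (a b : R) (n i : nat) :
  (0 < n)%nat -> node a b n (i + 1) = node a b n i + (b - a) / INR n.
Proof.
  intros Hn. apply lt_0_INR in Hn. unfold node.
  rewrite plus_INR. simpl (INR 1). field. lra.
Qed.

Lemma node_bounds (a b : R) (n i : nat) :
  a <= b -> (0 < n)%nat -> (i <= n)%nat -> a <= node a b n i <= b.
Proof.
  intros Hab Hn Hi. apply lt_0_INR in Hn. apply le_INR in Hi.
  assert (Hi0 := pos_INR i). unfold node.
  assert (H : 0 <= INR i / INR n <= 1).
  { split.
    - apply Rle_div_r; lra.
    - apply Rle_div_l; lra. }
  replace ((b - a) * INR i / INR n) with ((b - a) * (INR i / INR n))
    by (field; lra).
  nra.
Qed.

Lemma simpson_error_nodes (a b : R) (n i : nat) (f : R -> R) :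
  (0 < n)%nat ->
  simpson_error (node a b n i) (node a b n (i + 2)) f
  = RInt f (node a b n i) (node a b n (i + 2))
    - (b - a) / (3 * INR n)
      * (f (node a b n i) + 4 * f (node a b n (i + 1)) + f (node a b n (i + 2))).
Proof.
  intros Hn. unfold simpson_error, simpson.
  replace ((node a b n i + node a b n (i + 2)) / 2) with (node a b n (i + 1)).
  - rewrite node_add_2 by easy. apply lt_0_INR in Hn. field. lra.
  - rewrite node_add_1, node_add_2 by easy. field.
    apply lt_0_INR in Hn. lra.
Qed.

(** Induction on the number [S k] of panels: the right end of one panel is the
    left end of the next, so each interior even node gets the weight 1 + 1 = 2.
    The induction starts from one panel, for which the sum over interior even
    nodes is empty. *)
Lemma composite_panels (a b C : R) (n : nat) (f : R -> R) :
  a <= b -> (0 < n)%nat ->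
  (forall c d, a <= c -> c <= d -> d <= b -> ex_RInt f c d) ->
  (forall i, (i + 2 <= n)%nat ->
     Rabs (simpson_error (node a b n i) (node a b n (i + 2)) f) <= C) ->
  forall k, (2 * S k <= n)%nat ->
  Rabs (RInt f a (node a b n (2 * S k))
        - (b - a) / (3 * INR n)
          * (f a
             + 2 * sum_n_m (fun i => f (node a b n (2 * i))) 1 k
             + 4 * sum_n_m (fun i => f (node a b n (2 * i - 1))) 1 (S k)
             + f (node a b n (2 * S k))))
    <= INR (S k) * C.
Proof.
  intros Hab Hn Hex HC.
  assert (E0 : node a b n 0 = a).
  { unfold node. simpl (INR 0). apply lt_0_INR in Hn. field. lra. }
  assert (Hord : forall i, node a b n i <= node a b n (i + 2)).
  { intros i. rewrite node_add_2 by easy.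
    assert (0 <= (b - a) / INR n)
      by (apply lt_0_INR in Hn; apply Rle_div_r; lra).
    lra. }
  induction k as [|k IH]; intros Hk.
  - rewrite (sum_n_m_zero _ 1 0), sum_n_n by lia.
    change (@zero R_AbelianMonoid) with 0.
    assert (H := HC 0%nat ltac:(lia)).
    rewrite simpson_error_nodes, E0 in H by easy.
    change (0 + 2)%nat with 2%nat in H. change (0 + 1)%nat with 1%nat in H.
    change (2 * 1)%nat with 2%nat. change (2 - 1)%nat with 1%nat.
    simpl (INR 1). rewrite Rmult_1_l, Rmult_0_r, Rplus_0_r. exact H.
  - specialize (IH ltac:(lia)).
    assert (H := HC (2 * S k)%nat ltac:(lia)).
    rewrite simpson_error_nodes in H by easy.
    rewrite (sum_n_Sm (fun i => f (node a b n (2 * i))) 1 k) by lia.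
    rewrite (sum_n_Sm (fun i => f (node a b n (2 * i - 1))) 1 (S k)) by lia.
    replace (2 * S (S k) - 1)%nat with (2 * S k + 1)%nat by lia.
    replace (2 * S (S k))%nat with (2 * S k + 2)%nat by lia.
    assert (B1 := node_bounds a b n (2 * S k) Hab Hn ltac:(lia)).
    assert (B2 := node_bounds a b n (2 * S k + 2) Hab Hn ltac:(lia)).
    rewrite <- (RInt_Chasles f a (node a b n (2 * S k))
                  (node a b n (2 * S k + 2)))
      by (apply Hex; try apply Hord; lra).
    rewrite (S_INR (S k)), Rmult_plus_distr_r, Rmult_1_l.
    change (@plus R_AbelianMonoid) with Rplus.
    change (@plus R_CompleteNormedModule) with Rplus.
    apply Rle_trans with (2 := Rplus_le_compat _ _ _ _ IH H).
    apply Rle_trans with (2 := Rabs_triang _ _).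
    right. f_equal. cbv beta. ring.
Qed.

Theorem mainTheorem3 (a b : R) (f : R -> R) (hab : a < b) (hf : C_on 4 a b f) :
  Rabs (simpson_error a b f)
    <= (b - a) ^ 5 * sup_norm a b (Derive_n_on a b f 4) / 2880
  /\
  (forall n : nat, (2 <= n)%nat -> Nat.Even n ->
     Rabs (composite_simpson_error a b n f)
       <= (b - a) ^ 5 * sup_norm a b (Derive_n_on a b f 4) / (180 * INR n ^ 4)).
Proof.
  split; [apply simpson_error_le; [exact hf|lra..]|].
  intros n Hn2 [m Hm].
  assert (Hab : a <= b) by lra.
  assert (Hn : (0 < n)%nat) by lia.
  assert (HnR := lt_0_INR n Hn).
  set (M := sup_norm a b (Derive_n_on a b f 4)).
  destruct m as [|k]; [lia|].
  assert (Hmid : (n / 2 = S k)%nat).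
  { rewrite Hm, Nat.mul_comm. now apply Nat.div_mul. }
  assert (Hend : node a b n n = b) by (unfold node; field; lra).
  unfold composite_simpson_error, composite_simpson.
  rewrite Hmid. replace (S k - 1)%nat with k by lia.
  assert (H : forall i, (i + 2 <= n)%nat ->
            Rabs (simpson_error (node a b n i) (node a b n (i + 2)) f)
              <= (2 * ((b - a) / INR n)) ^ 5 * M / 2880).
  { intros i Hi.
    assert (B1 := node_bounds a b n i Hab Hn ltac:(lia)).
    assert (B2 := node_bounds a b n (i + 2) Hab Hn Hi).
    assert (Hw : node a b n (i + 2) - node a b n i = 2 * ((b - a) / INR n))
      by (rewrite node_add_2 by easy; ring).
    assert (0 <= (b - a) / INR n) by (apply Rle_div_r; lra).
    rewrite <- Hw. apply simpson_error_le; [exact hf|lra..]. }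
  apply (composite_panels a b _ n f Hab Hn) with (k := k) in H; [| |lia].
  - rewrite <- Hm, Hend in H. apply Rle_trans with (1 := H). right.
    assert (HnE : INR n = 2 * INR (S k)).
    { rewrite Hm, mult_INR. reflexivity. }
    replace (INR (S k)) with (INR n / 2) by (rewrite HnE; field).
    field. lra.
  - intros c d. apply ex_RInt_of_continue_in. intros x Hx.
    apply (proj2 hf 0%nat x); [lia|exact Hx].
Qed.
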